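(* Failed literal elimination and equivalent literal elimination are sampling-safe. That is, let $\varphi$ be a CNF formula with concrete feature set $\mathcal{C}$ and let $\psi$ (with concrete feature set $\mathcal{C}'$) be obtained from $\varphi$ by failed and equivalent literal elimination. Then for every sample $S_\varphi$ of $\varphi$ with pairwise coverage there is a sample $S_\psi$ of $\psi$ with pairwise coverage and $|S_\psi|=|S_\varphi|$, and for every sample $S_\psi$ of $\psi$ with pairwise coverage there is a sample $S_\varphi$ of $\varphi$ with pairwise coverage and $|S_\varphi|=|S_\psi|$.
   Context: A CNF formula $\varphi$ over Boolean features $\mathcal{F}$ with concrete features $\mathcal{C}\subseteq\mathcal{F}$. Configurations are satisfying assignments, viewed as sets of literals. A pairwise interaction is a set of 2 literals of concrete features; it is feasible if contained in some satisfying assignment. A sample (set of satisfying assignments) has pairwise coverage if it covers (contains as subset of a member) every feasible pairwise interaction; additionally, by convention, if the formula is satisfiable the sample must contain at least one configuration, and if there is exactly one concrete feature $x$ and both $x$ and $\overline{x}$ occur in satisfying assignments, the sample must contain a configuration with $x$ and one with $\overline{x}$. Unit propagation: for a partial assignment $Q$ (a set of literals with no complementary pair), repeatedly add the remaining literal of any clause in which all but one literal are false under $Q$ and the remaining one is unassigned, until none remain or some clause has all literals false; $\mathrm{UP}(Q)$ is the result, or $\bot$ in the latter (conflict) case. Failed literal elimination: a literal $\ell$ is failed if $\mathrm{UP}(\{\ell\})=\bot$, or if for some literal $\ell'$ both $\overline{\ell}\in\mathrm{UP}(\{\ell'\})$ and $\overline{\ell}\in\mathrm{UP}(\{\overline{\ell'}\})$;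 it is eliminated by fixing $\ell$ to false, removing clauses this satisfies and removing $\ell$ from the remaining clauses. Equivalent literal elimination: in the directed graph on literals with an arc $(\ell_1,\ell_2)$ whenever $\ell_2\in\mathrm{UP}(\{\ell_1\})$, each strongly connected component is a set of equivalent literals; all variables of a component are replaced by a single representative variable (rewriting clauses accordingly), and the representative is concrete if any replaced variable is concrete. *)

(* Defs.v *)
From mathcomp Require Import all_boot.

Set Implicit Arguments.
Unset Strict Implicit.
Unset Printing Implicit Defensive.

(* (x, true) is the literal x and (x, false) is its complement. *)
Definition lit (V : finType) : finType := (V * bool)%type.
Definition neg (V : finType) (l : lit V) : lit V := (l.1, ~~ l.2).
Lemma negK (V : finType) : involutive (@neg V).
Proof. by case=> x []. Qed.
Lemma neg_neq (V : finType) (l : lit V) : neg l != l.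
Proof. by case: l => x b; apply/eqP => -[]; case: b. Qed.
Definition lits (V : finType) (X : {set V}) : {set lit V} :=
  [set l : lit V | l.1 \in X].

(* The feature set is a component of the formula because elimination removes
   features; V is only an ambient supply of feature names. *)
Record cnf (V : finType) := Cnf {
  features : {set V};
  concrete : {set V};
  clauses : {set {set lit V}}
}.

Definition well_formed (V : finType) (phi : cnf V) : Prop :=
  concrete phi \subset features phi /\
  (forall c, c \in clauses phi -> c \subset lits (features phi)).

Section Sampling.
Variables (V : finType) (phi : cnf V).

Definition configuration (A : {set lit V}) : Prop :=
  [/\ A \subset lits (features phi),
      (forall l, l \in lits (features phi) -> (neg l \in A) = (l \notin A)) &
      (forall c, c \in clauses phi -> exists2 l, l \in c & l \in A)].

Definition sample (S : {set {set lit V}}) : Prop :=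
  forall A, A \in S -> configuration A.

Definition interaction (I : {set lit V}) : Prop :=
  I \subset lits (concrete phi) /\ #|I| = 2.

Definition feasible (I : {set lit V}) : Prop :=
  exists2 A, configuration A & I \subset A.

Definition covers (S : {set {set lit V}}) (I : {set lit V}) : Prop :=
  exists2 A, A \in S & I \subset A.

Definition pairwise_coverage (S : {set {set lit V}}) : Prop :=
  [/\ (forall I, interaction I -> feasible I -> covers S I),
      ((exists A, configuration A) -> exists A, A \in S) &
      (forall x, concrete phi = [set x] ->
         feasible [set (x, true)] -> feasible [set (x, false)] ->
         covers S [set (x, true)] /\ covers S [set (x, false)])].

End Sampling.

Section UnitPropagation.
Variables (V : finType) (phi : cnf V).

Definition conflict (Q : {set lit V}) : bool :=
  [exists c in clauses phi, [forall l in c, neg l \in Q]].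

Definition unit_literal (Q : {set lit V}) (l : lit V) : bool :=
  [&& l \notin Q, neg l \notin Q &
    [exists c in clauses phi,
      (l \in c) && [forall m in c, (m != l) ==> (neg m \in Q)]]].

Definition up_step : rel {set lit V} := fun Q R =>
  ~~ conflict Q && [exists l, unit_literal Q l && (R == l |: Q)].

Definition up_final (R : {set lit V}) : bool :=
  conflict R || [forall l, ~~ unit_literal R l].

(* None stands for the conflict value of UP. The propagation order is left to
   [pick], which UP_any_order shows to be immaterial; by up_terminates the last
   branch is never reached. *)
Definition UP (Q : {set lit V}) : option {set lit V} :=
  if [pick R | connect up_step Q R && up_final R] is Some R
  then if conflict R then None else Some R
  else None.

Lemma up_terminates (Q : {set lit V}) : exists R, connect up_step Q R && up_final R.
Proof.
have [n] := ubnP #|~: Q|; elim: n Q => // n IHn Q ltQn.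
have [finQ|] := boolP (up_final Q); first by exists Q; rewrite connect0.
rewrite negb_or negb_forall => /andP[nconf /existsP[l]]; rewrite negbK => ul.
have lQ : l \notin Q by case/and3P: ul.
have [|R /andP[QR finR]] := IHn (l |: Q).
  have: ~: (l |: Q) \proper ~: Q.
    rewrite properE !setCS subsetUr /=; apply/negP => /subsetP/(_ l).
    by rewrite setU11 (negPf lQ) => /(_ isT).
  by move/proper_card => lt; apply: leq_trans lt _; rewrite -ltnS.
exists R; rewrite finR andbT; apply: connect_trans QR; apply: connect1.
by rewrite /up_step nconf; apply/existsP; exists l; rewrite ul eqxx.
Qed.

Lemma conflictS (Q R : {set lit V}) : Q \subset R -> conflict Q -> conflict R.
Proof.
move=> /subsetP QR /exists_inP[c cphi /forall_inP cQ].
by apply/exists_inP; exists c => //; apply/forall_inP => l /cQ /QR.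
Qed.

Lemma up_reach_sub (Q Q' R : {set lit V}) : up_final R -> ~~ conflict R ->
  Q \subset R -> connect up_step Q Q' -> Q' \subset R.
Proof.
move=> finR nconf QR /connectP[p pathp ->] {Q'}.
elim: p Q QR pathp => //= Q' p IHp Q QR /andP[/andP[_ st] pathp].
apply: IHp pathp; case/existsP: st => l /andP[ul /eqP->].
rewrite subUset QR andbT sub1set.
case/and3P: ul => _ _ /exists_inP[c cphi /andP[lc /forall_inP cQ]].
have cR m : m \in c -> m != l -> neg m \in R.
  by move=> mc ml; apply: (subsetP QR); apply: (implyP (cQ m mc)).
have nlR : neg l \notin R.
  apply: contra nconf => nlR; apply/exists_inP; exists c => //.
  by apply/forall_inP => m mc; have [->|/cR->] := eqVneq m l.
move: finR; rewrite /up_final (negPf nconf) => /forallP/(_ l).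
apply: contraNT => lR; apply/and3P; split=> //.
apply/exists_inP; exists c => //; rewrite lc.
by apply/forall_inP => m mc; apply/implyP; apply: cR.
Qed.

Lemma UP_any_order (Q R : {set lit V}) : connect up_step Q R -> up_final R ->
  UP Q = if conflict R then None else Some R.
Proof.
have sub0 (Q' : {set lit V}) : connect up_step Q Q' -> Q \subset Q'.
  case/connectP=> p pathp ->; elim: p Q pathp => //= Q1 p IHp Q0 /andP[st pp].
  apply: subset_trans (IHp _ pp); case/andP: st => _ /existsP[l /andP[_ /eqP->]].
  exact: subsetUr.
move=> QR finR; rewrite /UP; case: pickP => [T /andP[QT finT] | none]; last first.
  by have := none R; rewrite QR finR.
have [cT|ncT] := boolP (conflict T); have [cR|ncR] := boolP (conflict R).
- by [].
- by case/negP: (ncR); apply: conflictS (up_reach_sub finR ncR (sub0 _ QR) QT) cT.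
- by case/negP: (ncT); apply: conflictS (up_reach_sub finT ncT (sub0 _ QT) QR) cR.
congr Some; apply/eqP; rewrite eqEsubset.
by rewrite (up_reach_sub finR ncR (sub0 _ QR) QT)
           (up_reach_sub finT ncT (sub0 _ QT) QR).
Qed.

Definition up_implies : rel (lit V) := fun l1 l2 =>
  if UP [set l1] is Some R then l2 \in R else false.

Lemma up_implies_trans : transitive up_implies.
Proof.
move=> b a c; rewrite /up_implies.
have [R /andP[aR finR]] := up_terminates [set a].
rewrite (UP_any_order aR finR); have [//|ncR bR] := boolP (conflict R).
have [T /andP[bT finT]] := up_terminates [set b].
rewrite (UP_any_order bT finT); case: ifP => // _.
by apply/subsetP; apply: up_reach_sub finR ncR _ bT; rewrite sub1set.
Qed.

Lemma up_implies_neg l : up_implies l (neg l) = false.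
Proof.
have cons Q R : connect up_step Q R ->
    (forall m, m \in Q -> neg m \notin Q) -> forall m, m \in R -> neg m \notin R.
  case/connectP=> p pathp ->; elim: p Q pathp => //= Q1 p IHp Q /andP[st pp] cQ.
  apply: IHp pp _ => m.
  case/andP: st => _ /existsP[k /andP[/and3P[kQ nkQ _] /eqP->]].
  rewrite !in_setU1 => /predU1P[-> | mQ]; rewrite negb_or.
    by rewrite nkQ andbT neg_neq.
  rewrite (cQ _ mQ) andbT; apply: contra nkQ => /eqP <-.
  by rewrite negK.
rewrite /up_implies; have [R /andP[lR finR]] := up_terminates [set l].
rewrite (UP_any_order lR finR); case: ifP => // _; apply/negbTE.
apply: (cons _ _ lR) => [m|].
  by rewrite !inE => /eqP->; exact: neg_neq.
have : [set l] \subset R.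
  case/connectP: lR => p pathp ->; elim: p [set l] pathp => //= Q1 p IHp Q.
  move=> /andP[/andP[_ /existsP[k /andP[_ /eqP Q1E]]] pp].
  by apply: subset_trans (IHp _ pp); rewrite Q1E subsetUr.
by rewrite sub1set.
Qed.

End UnitPropagation.

Section FailedLiterals.
Variables (V : finType) (phi : cnf V).

Definition failed (l : lit V) : Prop :=
  l \in lits (features phi) /\
  (UP phi [set l] = None \/
   exists l', [/\ l' \in lits (features phi),
                  up_implies phi l' (neg l) &
                  up_implies phi (neg l') (neg l)]).

(* The feature of l is now determined, so it is dropped from the feature sets;
   keeping it would turn it into an unconstrained feature. *)
Definition eliminate_failed (l : lit V) : cnf V :=
  Cnf (features phi :\ l.1) (concrete phi :\ l.1)
      [set c :\ l | c in [set c in clauses phi | neg l \notin c]].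

End FailedLiterals.

Section EquivalentLiterals.
Variables (V : finType) (phi : cnf V).

Definition up_arc : rel (lit V) := fun l1 l2 =>
  [&& l1 \in lits (features phi), l2 \in lits (features phi) &
      up_implies phi l1 l2].

Definition component (l : lit V) : {set lit V} :=
  [set l' | connect up_arc l l' && connect up_arc l' l].

Definition components : {set {set lit V}} :=
  [set component l | l in lits (features phi)].

(* Replacing the variables of a component K identifies the literals of K and
   also their complements, although the latter need not form a component. *)
Definition identified (KK : {set {set lit V}}) : rel (lit V) := fun l l' =>
  [exists K in KK,
    ((l \in K) && (l' \in K)) || ((neg l \in K) && (neg l' \in K))].

(* s substitutes literals so as to merge the components in KK: s is constant on
   each of them, and s l is always a literal that KK identifies with l (so
   s l = l when the variable of l does not occur in KK). Components in KK may
   share variables, hence the transitive closure. By merges_component below, any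
   single component can be replaced by any one of its literals. *)
Definition merges (KK : {set {set lit V}}) (s : lit V -> lit V) : Prop :=
  [/\ KK \subset components,
      (forall l, s (neg l) = neg (s l)),
      (forall K, K \in KK -> {in K &, forall l l', s l = s l'}) &
      (forall l, connect (identified KK) l (s l))].

Definition replace_component (K : {set lit V}) (r l : lit V) : lit V :=
  if l \in K then r else if neg l \in K then neg r else l.

Lemma component_neg l m : m \in component l -> neg m \notin component l.
Proof.
rewrite !inE => /andP[_ ml]; apply/negP => /andP[lm' _].
have: connect up_arc m (neg m) by apply: connect_trans ml lm'.
case/connectP=> p pathp; suff lastE k : path up_arc k p ->
    (last k p == k) || up_implies phi k (last k p).
  move=> E; have := lastE m pathp; rewrite -E up_implies_neg orbF.
  by rewrite (negPf (neg_neq m)).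
elim: p k {pathp} => [|k' p IHp] k /=; first by rewrite eqxx.
case/andP=> /and3P[_ _ kk'] /IHp /orP[/eqP-> | k'l]; first by rewrite kk' orbT.
by rewrite (up_implies_trans kk' k'l) orbT.
Qed.

Lemma merges_component l r :
  l \in lits (features phi) -> r \in component l ->
  merges [set component l] (replace_component (component l) r).
Proof.
move=> lF rK; rewrite /replace_component; split.
- by rewrite sub1set; apply: imset_f.
- move=> m; rewrite negK; have [nm|_] := boolP (neg m \in _); last by case: ifP.
  have [mK|_] := boolP (m \in _); last by rewrite negK.
  by rewrite (negPf (component_neg mK)) in nm.
- by move=> K /set1P-> m m' -> ->.
move=> m; case: ifP => mK.
  apply: connect1; apply/exists_inP; exists (component l); first exact: set11.
  by rewrite mK rK.
case: ifP => nmK; last exact: connect0.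
apply: connect1; apply/exists_inP; exists (component l); first exact: set11.
by rewrite nmK negK rK orbT.
Qed.

Definition substitute (s : lit V -> lit V) : cnf V :=
  let rep x := (s (x, true)).1 in
  Cnf [set rep x | x in features phi] [set rep x | x in concrete phi]
      [set [set s l | l in c] | c : {set lit V} in clauses phi].

End EquivalentLiterals.

(* Any finite number of eliminations, in any order; the failed literals and the
   components are those of the current formula. *)
Inductive eliminates (V : finType) : cnf V -> cnf V -> Prop :=
| Elim_refl phi : eliminates phi phi
| Elim_failed phi l psi :
    failed phi l -> eliminates (eliminate_failed phi l) psi ->
    eliminates phi psi
| Elim_equivalent phi KK s psi :
    merges phi KK s -> eliminates (substitute phi s) psi ->
    eliminates phi psi.

(* Main.v *)
Require Import Defs.
From mathcomp Require Import all_boot.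

(** Every configuration of [phi] is closed under unit propagation, so it contains
    the complement of a failed literal and does not separate equivalent literals.
    Hence each elimination step induces a bijection between the configurations of
    the two formulas, and samples are transported along it.  The conventions on
    empty and one-element feature sets say exactly that a sample covers every
    feasible set of _at most_ two concrete literals; in this form coverage is
    transported too, as a step sends a set of at most two concrete literals to
    another one. *)

Set Implicit Arguments.
Unset Strict Implicit.
Unset Printing Implicit Defensive.

(** * Coverage as a condition on sets of at most two concrete literals *)

Section Coverage.
Variables (V : finType) (phi : cnf V).
Implicit Types (A I : {set lit V}) (S : {set {set lit V}}).

Lemma lits_neg (X : {set V}) l : (neg l \in lits X) = (l \in lits X).
Proof. by rewrite !inE. Qed.

Lemma litsS (X Y : {set V}) : X \subset Y -> lits X \subset lits Y.
Proof. by move/subsetP=> XY; apply/subsetP => l; rewrite !inE => /XY. Qed.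

Lemma configuration_neg A l : configuration phi A -> l \in A -> neg l \notin A.
Proof.
by case=> /subsetP AF Aneg _ lA; rewrite (Aneg l (AF _ lA)) lA.
Qed.

Lemma same_feature (l m : lit V) : l.1 = m.1 -> l = m \/ l = neg m.
Proof.
case: l m => [x b] [y c] /= ->; rewrite /neg /=.
by case: b c => [] []; [left|right|right|left].
Qed.

(** Size 0 is the convention on satisfiable formulas. A single literal is covered through a pair
    containing it, or through the convention on a unique concrete feature. *)
Lemma pairwise_coverageP S : concrete phi \subset features phi -> sample phi S ->
  pairwise_coverage phi S <->
  forall I, I \subset lits (concrete phi) -> #|I| <= 2 -> feasible phi I ->
    covers S I.
Proof.
move=> /litsS /subsetP CF smpS; split=> [[cov2 cov0 cov1] I IC I2 feasI | cov].
- move: I2; rewrite leq_eqVlt => /predU1P[I2|]; first exact: cov2.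
  have [A confA IA] := feasI; have [AF Aneg _] := confA.
  have [B BS] : exists B, B \in S by apply: cov0; exists A.
  rewrite ltnS leq_eqVlt => /predU1P[/eqP/cards1P[l IE]|]; last first.
    by rewrite ltnS leqn0 cards_eq0 => /eqP->; exists B; rewrite ?sub0set.
  subst I; move: IC IA; rewrite !sub1set => lC lA.
  have [CE|neqC] := eqVneq (concrete phi) [set l.1].
    (* A member [B] of [S] that avoids [l] contains [neg l], so both literals of the only concrete
       feature are feasible and the convention applies. *)
    have [lB|lnB] := boolP (l \in B); first by exists B; rewrite ?sub1set.
    have feasn : feasible phi [set neg l].
      exists B; first exact: smpS.
      by have [_ Bneg _] := smpS B BS; rewrite sub1set Bneg ?CF.
    by case: l CE feasI feasn {lC lA lnB} => x [] /cov1 cov f1 f2;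
      case: cov.
  have [y yC yl] : exists2 y, y \in concrete phi & y != l.1.
    apply/exists_inP; apply: contraR neqC; rewrite negb_exists_in.
    move=> /forall_inP Cl; rewrite eqEsubset sub1set; move: lC; rewrite inE.
    by move=> ->; rewrite andbT; apply/subsetP => y /Cl; rewrite inE negbK.
  (* [m] is the literal of [y] that holds in [A]; hence the pair of [l] and [m] is a feasible
     interaction. *)
  pose m : lit V := (y, (y, true) \in A).
  have mA : m \in A.
    rewrite /m; have [//|ynA] := boolP ((y, true) \in A).
    have /Aneg : (y, true) \in lits (features phi) by apply: CF; rewrite inE.
    by rewrite ynA.
  have [|| B' B'S /subsetP lmB'] := cov2 [set l; m].
  + split; first by rewrite subUset !sub1set lC inE.
    by rewrite cards2; suff -> : l != m by []; apply: contraNneq yl => ->.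
  + by exists A; rewrite // subUset !sub1set lA.
  by exists B'; rewrite // sub1set lmB' ?set21.
split=> [I [IC I2] | [A confA] | x CE f1 f2].
- by apply: cov; rewrite ?I2.
- have [|||B] := cov set0; rewrite ?sub0set ?cards0 //; last by exists B.
  by exists A; rewrite ?sub0set.
by split; apply: cov; rewrite ?cards1 ?sub1set ?inE ?CE ?set11.
Qed.

End Coverage.

(** * Transport of samples along maps of configurations *)

Section Transfer.
Variable V : finType.
Implicit Types (phi psi : cnf V) (A I J : {set lit V}) (S : {set {set lit V}}).

(** One half of a bijection; [transfers psi phi g f] is the other. The set [J] must serve all
    configurations [A] at once. Feasibility of [I] is assumed because a set containing a failed
    literal may have no counterpart. *)
Definition transfers phi psi (f g : {set lit V} -> {set lit V}) : Prop :=
  [/\ forall A, configuration phi A -> configuration psi (f A),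
      forall A, configuration phi A -> g (f A) = A &
      forall I, I \subset lits (concrete phi) -> #|I| <= 2 -> feasible phi I ->
        exists J : {set lit V}, [/\ J \subset lits (concrete psi), #|J| <= 2 &
          forall A, configuration phi A -> (I \subset A) = (J \subset f A)]].

Definition sample_transport phi psi : Prop :=
  forall S, sample phi S -> pairwise_coverage phi S ->
  exists S', [/\ sample psi S', pairwise_coverage psi S' & #|S'| = #|S|].

(** The new sample is the image under [g], which is injective on [S] because [f] inverts it. A
    feasible [I] yields a feasible [J]; a member [B] covering [J] equals [f (g B)], so [g B] covers
    [I]. *)
Lemma transfers_sample phi psi f g :
  concrete phi \subset features phi -> concrete psi \subset features psi ->
  transfers phi psi f g -> transfers psi phi g f -> sample_transport psi phi.
Proof.
move=> Cphi Cpsi [fconf _ fI] [gconf gK _] S smpS covS.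
have smpS' : sample phi [set g B | B in S].
  by move=> A /imsetP[B BS ->]; apply/gconf/smpS.
exists [set g B | B in S]; split=> //; last first.
  apply: card_in_imset => B B' /smpS/gK BE /smpS/gK B'E gBB'.
  by rewrite -BE gBB'.
apply/pairwise_coverageP => // I IC I2 feasI.
have [J [JC J2 IJ]] := fI I IC I2 feasI.
have [A confA IA] := feasI.
have [|||B BS JB] := (pairwise_coverageP Cpsi smpS).1 covS J => //.
  by exists (f A); [exact: fconf | rewrite -IJ].
have confB := smpS B BS.
by exists (g B); [exact: imset_f | rewrite IJ ?gK //; exact: gconf].
Qed.

Lemma sample_transport_trans phi psi chi :
  sample_transport phi psi -> sample_transport psi chi ->
  sample_transport phi chi.
Proof.
move=> t1 t2 S smpS /(t1 S smpS)[S1 [smp1 /(t2 S1 smp1)[S2 [smp2 cov2 E2]] E1]].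
by exists S2; rewrite E2.
Qed.

End Transfer.

(** * Configurations are closed under unit propagation *)

Section Soundness.
Variables (V : finType) (phi : cnf V).
Implicit Types (A Q R : {set lit V}).

Lemma configuration_no_conflict A : configuration phi A -> ~~ conflict phi A.
Proof.
move=> confA; apply/exists_inP => -[c cphi /forall_inP cA].
have [_ _ /(_ c cphi)[l lc lA]] := confA.
by case/negP: (configuration_neg confA lA); apply: cA.
Qed.

Lemma configuration_up A Q R : configuration phi A ->
  Q \subset A -> connect (up_step phi) Q R -> R \subset A.
Proof.
move=> confA QA /connectP[p pathp ->] {R}.
elim: p Q QA pathp => //= R p IHp Q /subsetP QA /andP[/andP[_ st] pathp].
apply: IHp pathp; case/existsP: st => l /andP[ul /eqP->].
case/and3P: ul => _ _ /exists_inP[c cphi /andP[lc /forall_inP cQ]].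
apply/subsetP => k /setU1P[->|/QA //].
(* The clause [c] has a literal [m] true in [A]. All its literals other than [l] are false under
   [Q], hence false in [A], so [m] is the propagated literal [l]. *)
have [_ _ /(_ c cphi)[m mc mA]] := confA.
have [<- //|ml] := eqVneq m l.
case/negP: (configuration_neg confA mA).
by apply: QA; apply: (implyP (cQ m mc)).
Qed.

Lemma configuration_UP A l : configuration phi A -> l \in A ->
  exists2 R, UP phi [set l] = Some R & R \subset A.
Proof.
move=> confA lA; have [R /andP[lR finR]] := up_terminates phi [set l].
have RA : R \subset A by apply: configuration_up lR; rewrite ?sub1set.
exists R => //; rewrite (UP_any_order lR finR) ifN //.
exact: contra (conflictS RA) (configuration_no_conflict confA).
Qed.

Lemma configuration_implies A l m : configuration phi A ->
  up_implies phi l m -> l \in A -> m \in A.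
Proof.
move=> confA lm lA; have [R UPR /subsetP RA] := configuration_UP confA lA.
by apply: RA; rewrite /up_implies UPR in lm.
Qed.

(** Propagating from inside a configuration never ends in conflict. In the other case [A] contains
    [m] or [neg m], and either one forces [neg l]. *)
Lemma failed_notin A l : failed phi l -> configuration phi A -> l \notin A.
Proof.
move=> [lF fail] confA; have [_ Aneg _] := confA; apply/negP => lA.
have nlA := negP (configuration_neg confA lA).
case: fail => [UPl | [m [mF ml nml]]].
  by have [R] := configuration_UP confA lA; rewrite UPl.
apply: nlA; have [mA|mA] := boolP (m \in A).
  exact: configuration_implies ml mA.
by apply: configuration_implies nml _; rewrite // Aneg.
Qed.

Lemma component_sub l : l \in lits (features phi) ->
  component phi l \subset lits (features phi).
Proof.
move=> lF; apply/subsetP => m; rewrite inE => /andP[_ /connectP[[|k p]]] /=.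
  by move=> _ <-.
by case/andP=> /and3P[].
Qed.

Lemma configuration_connect A l m : configuration phi A ->
  connect (up_arc phi) l m -> l \in A -> m \in A.
Proof.
move=> confA /connectP[p pathp ->].
elim: p l pathp => //= k p IHp l /andP[/and3P[_ _ lk] pathp] lA.
by apply: IHp pathp _; apply: configuration_implies lk lA.
Qed.

Lemma configuration_component A K l m : configuration phi A ->
  K \in components phi -> l \in K -> m \in K -> (l \in A) = (m \in A).
Proof.
move=> confA /imsetP[k _ ->]; rewrite !inE => /andP[kl lk] /andP[km mk].
apply/idP/idP; apply: configuration_connect => //.
  exact: connect_trans lk km.
exact: connect_trans mk kl.
Qed.

End Soundness.

(** * Failed literal elimination *)

Section FailedElimination.
Variables (V : finType) (phi : cnf V) (l : lit V).
Hypothesis fl : failed phi l.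
Let psi := eliminate_failed phi l.

Lemma eliminate_failed_wf : well_formed phi -> well_formed psi.
Proof.
case=> CF clF; split; first exact: setSD.
move=> _ /imsetP[c /[!inE]/andP[cphi nlc] ->].
apply/subsetP => m /setD1P[ml mc]; have := subsetP (clF c cphi) m mc.
rewrite !inE => ->; rewrite andbT; apply/eqP => /same_feature[E|E].
  by rewrite E eqxx in ml.
by rewrite -E mc in nlc.
Qed.

Lemma failed_neg_in A : configuration phi A -> neg l \in A.
Proof.
move=> confA; have [_ Aneg _] := confA.
by rewrite Aneg ?(failed_notin fl) //; case: fl.
Qed.

Lemma neg_notin_eliminated A : configuration psi A -> neg l \notin A.
Proof. by case=> /subsetP AF _ _; apply/negP => /AF; rewrite !inE eqxx. Qed.

Lemma failed_restrict_configuration A :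
  configuration phi A -> configuration psi (A :\ neg l).
Proof.
move=> confA; have lA := failed_notin fl confA; have [AF Aneg Acl] := confA.
split=> [|m|_ /imsetP[c /[!inE]/andP[cphi nlc] ->]].
- apply/subsetP => m /setD1P[ml mA]; have := subsetP AF m mA.
  rewrite !inE => ->; rewrite andbT; apply/eqP => /same_feature[E|E].
    by rewrite -E mA in lA.
  by rewrite E eqxx in ml.
- rewrite !inE => /andP[ml mF]; rewrite Aneg ?inE //.
  rewrite (inj_eq (inv_inj (@negK V))).
  have -> : (m == l) = false by apply: contraNF ml => /eqP->.
  by have -> : (m == neg l) = false by apply: contraNF ml => /eqP->.
(* The true literal [m] survives both deletions: it is not [l], which is false in [A], nor [neg l],
   which a retained clause does not contain. *)
have [m mc mA] := Acl c cphi; exists m; rewrite !inE ?mc ?mA andbT.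
  by apply: contraNneq lA => <-.
by apply: contraNneq nlc => <-.
Qed.

(** A clause of [phi] either contains [neg l] or is satisfied through its shortened form in
    [psi]. *)
Lemma failed_extend_configuration A :
  configuration psi A -> configuration phi (neg l |: A).
Proof.
case=> /subsetP AF Aneg Acl; have [lF _] := fl.
have nA m : m.1 = l.1 -> m \notin A.
  by move=> ml; apply/negP => /AF; rewrite !inE ml eqxx.
split=> [|m mF|c cphi].
- apply/subsetP => m /setU1P[->|/AF]; first by rewrite lits_neg.
  by rewrite !inE => /andP[].
- rewrite !inE (inj_eq (inv_inj (@negK V))).
  have [ml|ml] := eqVneq m.1 l.1.
    rewrite (negPf (nA m ml)) (negPf (nA (neg m) ml)) !orbF.
    case: (same_feature ml) => ->; first by rewrite eqxx eq_sym neg_neq.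
    by rewrite eqxx (negPf (neg_neq l)).
  rewrite Aneg; last by move: mF; rewrite !inE ml.
  have -> : (m == l) = false by apply: contraNF ml => /eqP->.
  by have -> : (m == neg l) = false by apply: contraNF ml => /eqP->.
have [nlc|nlc] := boolP (neg l \in c); first by exists (neg l); rewrite ?setU11.
have [|m /setD1P[_ mc] mA] := Acl (c :\ l).
  by apply: imset_f; rewrite inE cphi.
by exists m; rewrite // inE mA orbT.
Qed.

Lemma failed_restrict_transfers :
  transfers phi psi (fun A => A :\ neg l) (fun A => neg l |: A).
Proof.
split=> [A|A confA|I IC I2 [B confB IB]].
- exact: failed_restrict_configuration.
- by rewrite setD1K // failed_neg_in.
(* Every configuration of [phi] contains [neg l], so dropping it from [I] loses nothing; [l] itself
   is not in [I], since [I] is feasible. *)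
exists (I :\ neg l); split.
- apply/subsetP => m /setD1P[ml mI]; have := subsetP IC m mI.
  rewrite !inE => ->; rewrite andbT; apply/eqP => /same_feature[E|E].
    by have := failed_notin fl confB; rewrite -E (subsetP IB).
  by rewrite E eqxx in ml.
- by apply: leq_trans I2; rewrite subset_leq_card // subsetDl.
move=> A confA; apply/idP/idP => [IA|]; first exact: setSD.
move/subsetP=> IA; apply/subsetP => m mI.
have [->|ml] := eqVneq m (neg l); first exact: failed_neg_in.
by have := IA m; rewrite !inE ml mI => /(_ isT).
Qed.

Lemma failed_extend_transfers :
  transfers psi phi (fun A => neg l |: A) (fun A => A :\ neg l).
Proof.
split=> [A|A confA|I IC I2 _]; first exact: failed_extend_configuration.
  by rewrite setU1K // neg_notin_eliminated.
exists I; split=> // [|A confA].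
  by apply: subset_trans IC _; apply: litsS; apply: subsetDl.
apply/idP/idP => [IA|/subsetP IA]; first exact: subset_trans IA (subsetUr _ _).
apply/subsetP => m mI; case/setU1P: (IA m mI) => // E.
by have := subsetP IC m mI; rewrite E !inE eqxx.
Qed.

End FailedElimination.

(** * Equivalent literal elimination *)

Section EquivalentElimination.
Variables (V : finType) (phi : cnf V).
Variables (KK : {set {set lit V}}) (s : lit V -> lit V).
Hypotheses (wf_phi : well_formed phi) (mergeK : merges phi KK s).
Let psi := substitute phi s.
Implicit Types A B I J : {set lit V}.

Lemma merges_neg m : s (neg m) = neg (s m).
Proof. by case: mergeK. Qed.

(** Follows the chain of identifications from [m] to [s m], so that claims about an arbitrary
    merging [s] reduce to two literals of one component. Complements are included since [identified]
    links them as well. *)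
Lemma merges_ind (R : lit V -> lit V -> Prop) :
  (forall m, R m m) -> (forall n m p, R m n -> R n p -> R m p) ->
  (forall K m n, K \in KK -> m \in K -> n \in K ->
     R m n /\ R (neg m) (neg n)) ->
  forall m, R m (s m).
Proof.
move=> Rrefl Rtrans RK m; have [_ _ _ /(_ m)/connectP[p]] := mergeK.
move=> pathp ->; elim: p m pathp => //= k p IHp m /andP[mk /IHp].
apply: Rtrans; case/exists_inP: mk => K KKK /orP[]/andP[mK kK].
  by case: (RK _ _ _ KKK mK kK).
by case: (RK _ _ _ KKK mK kK); rewrite !negK.
Qed.

Lemma merges_components K : K \in KK ->
  K \in components phi /\ K \subset lits (features phi).
Proof.
have [/subsetP KKc _ _ _] := mergeK => /KKc Kc; split=> //.
by case/imsetP: Kc => m mF ->; apply: component_sub.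
Qed.

Lemma merges_features m :
  (s m \in lits (features phi)) = (m \in lits (features phi)).
Proof.
apply/esym; move: m.
apply: (@merges_ind (fun m n => (m \in lits _) = (n \in lits _))) => //.
  by move=> n m p ->.
move=> K m n /merges_components[_ /subsetP KF] /KF mF /KF nF.
by rewrite !lits_neg mF nF.
Qed.

Lemma merges_configuration A m : configuration phi A -> (s m \in A) = (m \in A).
Proof.
move=> confA; have [_ Aneg _] := confA; apply/esym; move: m.
apply: (@merges_ind (fun m n => (m \in A) = (n \in A))) => //.
  by move=> n m p ->.
move=> K m n /merges_components[Kc /subsetP KF] mK nK.
by rewrite !Aneg ?KF // (configuration_component confA Kc mK nK).
Qed.

Lemma merges_idem m : s (s m) = s m.
Proof.
apply/esym; move: m; apply: (@merges_ind (fun m n => s m = s n)) => //.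
  by move=> n m p ->.
have [_ _ sK _] := mergeK.
by move=> K m n KKK mK nK; rewrite !merges_neg (sK K KKK m n).
Qed.

Lemma merges_lits (X : {set V}) m :
  m \in lits X -> s m \in lits [set (s (x, true)).1 | x in X].
Proof.
rewrite !inE; case: m => x b /= xX.
suff -> : (s (x, b)).1 = (s (x, true)).1 by apply: imset_f.
by case: b => //; have /= -> := merges_neg (x, true).
Qed.

Lemma merges_litsP (X : {set V}) m :
  m \in lits [set (s (x, true)).1 | x in X] -> exists2 n, n \in lits X & s n = m.
Proof.
rewrite inE => /imsetP[x xX /same_feature[]->]; first by exists (x, true); rewrite ?inE.
by exists (x, false); rewrite ?inE // -merges_neg.
Qed.

Lemma substitute_features_sub : features psi \subset features phi.
Proof.
apply/subsetP => x xF.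
have /merges_litsP[n nF nx] : (x, true) \in lits (features psi) by rewrite inE.
by move: nF; rewrite -merges_features nx inE.
Qed.

Lemma merges_fixed m : m \in lits (features psi) -> s m = m.
Proof. by case/merges_litsP=> n _ <-; rewrite merges_idem. Qed.

Lemma substitute_wf : well_formed psi.
Proof.
have [CF clF] := wf_phi; split; first exact: imsetS.
move=> _ /imsetP[c cphi ->]; apply/subsetP => _ /imsetP[m mc ->].
by apply: merges_lits; apply: (subsetP (clF c cphi)).
Qed.

Definition equiv_restrict A : {set lit V} := A :&: lits (features psi).
Definition equiv_extend B : {set lit V} := [set m in lits (features phi) | s m \in B].

Lemma mem_equiv_restrict A m : configuration phi A ->
  m \in lits (features phi) -> (s m \in equiv_restrict A) = (m \in A).
Proof.
by move=> confA mF; rewrite in_setI merges_configuration // merges_lits ?andbT.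
Qed.

Lemma equiv_restrict_configuration A :
  configuration phi A -> configuration psi (equiv_restrict A).
Proof.
move=> confA; have [AF Aneg Acl] := confA; split=> [|m mF|].
- exact: subsetIr.
- rewrite !in_setI lits_neg mF !andbT Aneg //.
  exact: subsetP (litsS substitute_features_sub) m mF.
move=> _ /imsetP[c cphi ->]; have [m mc mA] := Acl c cphi.
exists (s m); first exact: imset_f.
by rewrite mem_equiv_restrict // (subsetP AF).
Qed.

(** Truth values are pulled back along [s]: complements are respected because [s] commutes with
    [neg], and a true literal of a rewritten clause is [s m] for some [m] in the original clause. *)
Lemma equiv_extend_configuration B :
  configuration psi B -> configuration phi (equiv_extend B).
Proof.
have [_ clF] := wf_phi => -[BF Bneg Bcl]; split=> [|m mF|c cphi].
- by apply/subsetP => m; rewrite in_set => /andP[].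
- rewrite [in LHS]in_set [in RHS]in_set lits_neg mF /= merges_neg.
  by rewrite Bneg // merges_lits.
have [|_ /imsetP[m mc ->] mB] := Bcl [set s m | m in c]; first exact: imset_f.
by exists m; rewrite // inE mB (subsetP (clF c cphi)).
Qed.

Lemma equiv_restrictK A :
  configuration phi A -> equiv_extend (equiv_restrict A) = A.
Proof.
move=> confA; have [/subsetP AF _ _] := confA; apply/setP => m; rewrite in_set.
have [mF|mF] := boolP (m \in lits _); first by rewrite mem_equiv_restrict.
by apply/esym; apply: contraNF mF => /AF.
Qed.

Lemma equiv_extendK B :
  configuration psi B -> equiv_restrict (equiv_extend B) = B.
Proof.
case=> /subsetP BF _ _; apply/setP => m; rewrite in_setI in_set.
have [mF|mF] := boolP (m \in lits (features psi)).
  rewrite merges_fixed // andbT.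
  by rewrite (subsetP (litsS substitute_features_sub) m mF).
by rewrite andbF; apply/esym; apply: contraNF mF => /BF.
Qed.

Lemma equiv_restrict_image A I : configuration phi A ->
  I \subset lits (features phi) ->
  (I \subset A) = ([set s m | m in I] \subset equiv_restrict A).
Proof.
move=> confA /subsetP IF; apply/subsetP/subsetP => [IA _ /imsetP[m mI ->]|IA m mI].
  by rewrite mem_equiv_restrict ?IA ?IF.
by rewrite -mem_equiv_restrict ?IF // IA // imset_f.
Qed.

Lemma equiv_restrict_transfers : transfers phi psi equiv_restrict equiv_extend.
Proof.
split=> [A|A|I IC I2 _]; [exact: equiv_restrict_configuration
  | exact: equiv_restrictK |].
exists [set s m | m in I]; split.
- by apply/subsetP => _ /imsetP[m /(subsetP IC) mC ->]; apply: merges_lits.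
- exact: leq_trans (leq_imset_card _ _) I2.
move=> A confA; apply: equiv_restrict_image => //.
by apply: subset_trans IC (litsS _); case: wf_phi.
Qed.

Lemma equiv_extend_transfers : transfers psi phi equiv_extend equiv_restrict.
Proof.
split=> [B|B|J JC J2 _]; [exact: equiv_extend_configuration
  | exact: equiv_extendK |].
(* [t] chooses a concrete preimage under [s]. For [m] in [J] one exists, since a representative is
   concrete only if it replaces a concrete variable, so the default [m] is not reached there. *)
pose t m := odflt m [pick n in lits (concrete phi) | s n == m].
have tP m : m \in J -> t m \in lits (concrete phi) /\ s (t m) = m.
  move=> /(subsetP JC)/merges_litsP[n nC nm]; rewrite /t.
  by case: pickP => [k /andP[kC /eqP]|/(_ n)] //=; rewrite nC nm eqxx.
have tC : [set t m | m in J] \subset lits (concrete phi).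
  by apply/subsetP => _ /imsetP[m /tP[tm _] ->].
have tJ : [set s m | m in [set t m | m in J]] = J.
  rewrite -imset_comp -[RHS]imset_id; apply: eq_in_imset => m mJ /=.
  by case: (tP m mJ).
exists [set t m | m in J]; split=> // [|B confB].
  exact: leq_trans (leq_imset_card _ _) J2.
have CF : concrete phi \subset features phi by case: wf_phi.
rewrite (equiv_restrict_image (equiv_extend_configuration confB)); last first.
  exact: subset_trans tC (litsS CF).
by rewrite equiv_extendK // tJ.
Qed.

End EquivalentElimination.

(** * Sequences of eliminations *)

Lemma eliminates_sample_transport (V : finType) (phi psi : cnf V) :
  well_formed phi -> eliminates phi psi ->
  sample_transport phi psi /\ sample_transport psi phi.
Proof.
move=> wf_phi phi_psi.
elim: phi psi / phi_psi wf_phi =>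
  [phi|phi l psi fl _ IH|phi KK s psi mK _ IH] wf.
- by split=> S smpS covS; exists S.
- have wf' := eliminate_failed_wf l wf; have [IH1 IH2] := IH wf'.
  have [CF _] := wf; have [CF' _] := wf'.
  have tr := failed_restrict_transfers fl; have te := failed_extend_transfers fl.
  split; [apply: sample_transport_trans IH1 | apply: sample_transport_trans IH2 _].
    (* [transfers_sample] carries samples from its second formula back to its first, so transport
       from [phi] takes the extension map first. *)
    exact: transfers_sample te tr.
  exact: transfers_sample tr te.
have wf' := substitute_wf wf mK; have [IH1 IH2] := IH wf'.
have [CF _] := wf; have [CF' _] := wf'.
have tr := equiv_restrict_transfers wf mK.
have te := equiv_extend_transfers wf mK.
split; [apply: sample_transport_trans IH1 | apply: sample_transport_trans IH2 _].
  exact: transfers_sample te tr.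
exact: transfers_sample tr te.
Qed.

Theorem theoremC1 (V : finType) (phi psi : cnf V)
    (wf_phi : well_formed phi) (phi_psi : eliminates phi psi) :
  (forall S_phi : {set {set lit V}},
     sample phi S_phi -> pairwise_coverage phi S_phi ->
     exists S_psi : {set {set lit V}},
       [/\ sample psi S_psi, pairwise_coverage psi S_psi &
           #|S_psi| = #|S_phi|]) /\
  (forall S_psi : {set {set lit V}},
     sample psi S_psi -> pairwise_coverage psi S_psi ->
     exists S_phi : {set {set lit V}},
       [/\ sample phi S_phi, pairwise_coverage phi S_phi &
           #|S_phi| = #|S_psi|]).
Proof. exact: eliminates_sample_transport. Qed.
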